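(* Consider the $2\times2$ quasilinear system in Jordan-block form $$u^1_t=\lambda(u^1,u^2)\,u^1_x+\mu(u^1,u^2)\,u^2_x,\qquad u^2_t=\lambda(u^1,u^2)\,u^2_x,$$ where $\lambda$ and $\mu$ are arbitrary (smooth) functions of $(u^1,u^2)$, with $\mu\neq0$. Linear degeneracy of the system is a necessary and sufficient condition for the system to admit a differential constraint $\Phi(x,t,u^1,u^2,p,q)=0$, where $p=u^1_x$ and $q=u^2_x$.
   Context: Linear degeneracy: a system $u^i_t=A^i_j(\mathbf{u})u^j_x$ of $n$ equations, with $\det(z\mathbb{I}-A)=z^n+f_1(\mathbf{u})z^{n-1}+\dots+f_n(\mathbf{u})$, is linearly degenerate if $\nabla f_1\,A^{n-1}+\nabla f_2\,A^{n-2}+\dots+\nabla f_n=0$ identically, where $\nabla f=(\partial f/\partial u^1,\dots,\partial f/\partial u^n)$ is a row vector. Here $n=2$ and $A=\begin{pmatrix}\lambda&\mu\\0&\lambda\end{pmatrix}$. Differential constraint: an additional differential equation $\Phi(x,t,u^1,u^2,p,q)=0$ of the same order as the system (first order), appended to the system and compatible with it. Compatibility: differentiating the constraint and the two equations of the system with respect to $x$ and $t$ gives six linear algebraic equations for the six second-order derivatives $u^1_{xx},u^1_{xt},u^1_{tt},u^2_{xx},u^2_{xt},u^2_{tt}$ (the first-order $t$-derivatives being expressed through the system as $u^1_t=\lambda p+\mu q$, $u^2_t=\lambda q$). The constraint is compatible with the system if, wherever $\Phi=0$, the $6\times6$ coefficient matrix of this linear system has rank less than $6$ (so that the common solutions have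 the same level of arbitrariness, one arbitrary function, as those of the constraint) and the resulting overdetermined system is consistent, i.e. the equality of mixed derivatives (Schwarz condition) holds identically modulo the system and the constraint.
   Formalization: The constraint must have (Φ_p,Φ_q)≠(0,0) on Φ=0 and, over every (u¹,u²), a point of Φ=0 with q≠0; otherwise Φ=q or Φ=(q−1)² is compatible for every λ, μ (e.g. λ=u¹, μ=1), so necessity fails. *)

(* Defs.v *)
From HB Require Import structures.
From mathcomp Require Import all_boot all_order all_algebra.
From mathcomp Require Import all_classical all_reals all_analysis.

Set Implicit Arguments.
Unset Strict Implicit.
Unset Printing Implicit Defensive.
Import Order.TTheory GRing.Theory Num.Theory.
Import numFieldNormedType.Exports.

Local Open Scope classical_set_scope.
Local Open Scope ring_scope.

Section calculus.
Context {R : realType} {n : nat}.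
Implicit Types (f : 'rV[R]_n -> R) (x : 'rV[R]_n).

Definition partial (i : 'I_n) f : 'rV[R]_n -> R :=
  fun x => 'D_(delta_mx 0 i) f x.

Definition gradient f x : 'rV[R]_n := \row_(i < n) partial i f x.

Definition iter_partial (s : seq 'I_n) f : 'rV[R]_n -> R :=
  foldr partial f s.

(* C^infinity on the open set D: all iterated partial derivatives exist and
   are (Frechet) differentiable, hence continuous, at every point of D. The
   values of f outside D are irrelevant. *)
Definition smooth_on (D : set 'rV[R]_n) f : Prop :=
  forall s x, D x -> differentiable (iter_partial s f) x.

(* The coefficient f_k of det (z I - A) = z^n + f_1 z^(n-1) + ... + f_n. *)
Definition charcoef (A : 'rV[R]_n -> 'M[R]_n) (k : nat) : 'rV[R]_n -> R :=
  fun u => (char_poly (A u))`_(n - k).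

Definition linearly_degenerate (Omega : set 'rV[R]_n)
    (A : 'rV[R]_n -> 'M[R]_n) : Prop :=
  forall u, Omega u ->
    \sum_(1 <= k < n.+1) gradient (charcoef A k) u *m A u ^+ (n - k) = 0.

End calculus.

Definition mx_of_rows {R : nzRingType} m n (s : seq (seq R)) : 'M[R]_(m, n) :=
  \matrix_(i < m, j < n) nth 0 (nth [::] s i) j.

(* The Jordan block (lam mu; 0 lam). *)
Definition jordan_system {R : realType} (lam mu : 'rV[R]_2 -> R) :
    'rV[R]_2 -> 'M[R]_2 :=
  fun u => mx_of_rows 2 2 [:: [:: lam u; mu u]; [:: 0; lam u]].

Definition i_u1 : 'I_2 := @Ordinal 2 0 isT.
Definition i_u2 : 'I_2 := @Ordinal 2 1 isT.

(* Points of the jet space are row vectors (x, t, u1, u2, p, q) with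
   p = u1_x and q = u2_x. *)
Definition j_x : 'I_6 := @Ordinal 6 0 isT.
Definition j_t : 'I_6 := @Ordinal 6 1 isT.
Definition j_u1 : 'I_6 := @Ordinal 6 2 isT.
Definition j_u2 : 'I_6 := @Ordinal 6 3 isT.
Definition j_p : 'I_6 := @Ordinal 6 4 isT.
Definition j_q : 'I_6 := @Ordinal 6 5 isT.

Section constraint.
Context {R : realType}.
Variables (lam mu : 'rV[R]_2 -> R) (Phi : 'rV[R]_6 -> R).
Implicit Type J : 'rV[R]_6.

Definition jet_u J : 'rV[R]_2 := mx_of_rows 1 2 [:: [:: J 0 j_u1; J 0 j_u2]].

Definition u1_t J : R := lam (jet_u J) * J 0 j_p + mu (jet_u J) * J 0 j_q.
Definition u2_t J : R := lam (jet_u J) * J 0 j_q.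

(* x- and t-derivatives of g(u1, u2) along solutions of the system. *)
Definition dx_of (g : 'rV[R]_2 -> R) J : R :=
  partial i_u1 g (jet_u J) * J 0 j_p + partial i_u2 g (jet_u J) * J 0 j_q.
Definition dt_of (g : 'rV[R]_2 -> R) J : R :=
  partial i_u1 g (jet_u J) * u1_t J + partial i_u2 g (jet_u J) * u2_t J.

(* The differentiated equations, in the unknowns
     u1_xx, u1_xt, u1_tt, u2_xx, u2_xt, u2_tt;
   the rows are, in order,
     d/dx and d/dt of Phi = 0,
     d/dx and d/dt of u1_t - lam * u1_x - mu * u2_x = 0,
     d/dx and d/dt of u2_t - lam * u2_x = 0. *)
Definition second_order_mx J : 'M[R]_6 :=
  let l := lam (jet_u J) in
  let m := mu (jet_u J) in
  let Pp := partial j_p Phi J in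
  let Pq := partial j_q Phi J in
  mx_of_rows 6 6 [::
    [:: Pp;  0;   0; Pq;  0;   0];
    [:: 0;   Pp;  0; 0;   Pq;  0];
    [:: - l; 1;   0; - m; 0;   0];
    [:: 0;   - l; 1; 0;   - m; 0];
    [:: 0;   0;   0; - l; 1;   0];
    [:: 0;   0;   0; 0;   - l; 1]].

Definition second_order_rhs J : 'cV[R]_6 :=
  let p := J 0 j_p in
  let q := J 0 j_q in
  mx_of_rows 6 1 [::
    [:: - (partial j_x Phi J + partial j_u1 Phi J * p
           + partial j_u2 Phi J * q)];
    [:: - (partial j_t Phi J + partial j_u1 Phi J * u1_t J
           + partial j_u2 Phi J * u2_t J)];
    [:: dx_of lam J * p + dx_of mu J * q];
    [:: dt_of lam J * p + dt_of mu J * q];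
    [:: dx_of lam J * q];
    [:: dt_of lam J * q]].

(* u_xt is a single unknown in the linear system, so its solvability is the
   equality of mixed derivatives. *)
Definition compatible_constraint (D : set 'rV[R]_6) : Prop :=
  forall J, D J -> Phi J = 0 ->
    (\rank (second_order_mx J) < 6)%N /\
    exists y : 'cV[R]_6, second_order_mx J *m y = second_order_rhs J.

(* Phi actually involves first-order derivatives at each point of Phi = 0;
   this rules out the zero function, squares such as (q - 1)^2, and constraints
   on x, t, u1, u2 alone. *)
Definition first_order_constraint (D : set 'rV[R]_6) : Prop :=
  forall J, D J -> Phi J = 0 ->
    partial j_p Phi J != 0 \/ partial j_q Phi J != 0.

(* The constraint leaves the values (u1, u2) in Omega unrestricted, without
   forcing u2_x = 0. The constraint q = 0, which freezes u2 and reduces the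
   system to a scalar equation, is compatible whatever lam and mu are. *)
Definition nontrivial_constraint (Omega : set 'rV[R]_2)
    (D : set 'rV[R]_6) : Prop :=
  forall u, Omega u ->
    exists J, [/\ D J, jet_u J = u, Phi J = 0 & J 0 j_q != 0].

Definition differential_constraint (Omega : set 'rV[R]_2)
    (D : set 'rV[R]_6) : Prop :=
  [/\ [/\ open D, (forall J, D J -> Omega (jet_u J)) & smooth_on D Phi],
      first_order_constraint D,
      nontrivial_constraint Omega D &
      compatible_constraint D].

End constraint.

Definition admits_differential_constraint {R : realType}
    (Omega : set 'rV[R]_2) (lam mu : 'rV[R]_2 -> R) : Prop :=
  exists (D : set 'rV[R]_6) (Phi : 'rV[R]_6 -> R),
    differential_constraint lam mu Phi Omega D.

(* Main.v *)
Require Import Defs.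
From mathcomp Require Import all_boot all_order all_algebra.
From mathcomp Require Import all_classical all_reals all_analysis.
From mathcomp Require Import ring lra.
Import Order.TTheory GRing.Theory Num.Theory.
Import numFieldNormedType.Exports.
Local Open Scope classical_set_scope.
Local Open Scope ring_scope.

(* Linear degeneracy means lam_u1 = 0. If it holds, lam_u2 =: g does not depend
   on u1 locally, and q (1 - t g(u)) = 1 is a compatible constraint.
   Conversely, on Z = {Phi = 0} the rank condition forces Phi_p = 0, so
   Phi_q <> 0, and consistency reduces to the vanishing of
     E = D_w Phi + Phi_q (lam_u1 p + lam_u2 q) q,
   where w = d/dt - lam d/dx + mu q d/du1. Differentiating Phi_p = 0 and E = 0
   along Z, in the directions w and d/dp corrected by multiples of d/dq, and
   eliminating the second derivatives of Phi by their symmetry leaves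
   lam_u1 q = 0. *)

(** * Directional derivatives and tangency to a zero set *)

Section differentials.
Context {R : realType} {V : normedModType R}.
Implicit Types (f F Phi : V -> R) (x v w : V).

Lemma differentiable_near0 f x (e : R) : differentiable f x -> 0 < e ->
  \forall h \near (0 : V), `|f (h + x) - f x - 'd f x h| <= e * `|h|.
Proof.
move=> /diff_locally/eqaddoP df e0; have := df e e0; apply: filterS => h /=.
by rewrite !fctE opprD addrA.
Qed.

Lemma is_derive_line f x v (t : R) : differentiable f (t *: v + x) ->
  is_derive t 1 (fun s : R => f (s *: v + x)) ('D_v f (t *: v + x)).
Proof.
move=> df; have /derivableP[d1 d2] := @diff_derivable _ _ _ f _ v df.
have E : (fun h : R =>
    h^-1 *: (f ((h *: (1 : R)  + t) *: v + x) - f (t *: v + x)))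
  = (fun h => h^-1 *: (f (h *: v + (t *: v + x)) - f (t *: v + x))).
  apply/funext => h; congr (_ *: (f _ - _)).
  by rewrite [_ *: 1]mulr1 scalerDl addrA.
by split; rewrite /derivable /derive /= ?E.
Qed.

Lemma deriveDZ f x v w (a : R) : differentiable f x ->
  'D_(v + a *: w) f x = 'D_v f x + a * 'D_w f x.
Proof. by move=> df; rewrite !deriveE// linearD linearZ. Qed.

(* Lagrange multipliers on the zero set of Phi. Instead of parametrizing it by
   the implicit function theorem, the intermediate value theorem yields zeros
   of Phi at x + s (v + k w) + O(e s), where k is the slope of the tangent. *)
Lemma tangent_derive_eq0 (D : set V) Phi F x v w :
    open D -> D x -> (forall y, D y -> differentiable Phi y) ->
    differentiable F x -> Phi x = 0 -> 'D_w Phi x != 0 ->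
    (forall s c : R, let y := c *: w + (s *: v + x) in
      D y -> Phi y = 0 -> F y = 0) ->
  'D_w Phi x * 'D_v F x = 'D_v Phi x * 'D_w F x.
Proof.
move=> oD Dx dPhi dF Phix b0 PhiF.
have Fx : F x = 0.
  by have := PhiF 0 0; rewrite /= !scale0r !add0r; apply.
set b : R := 'D_w Phi x in b0 *.
(* Correcting [v] by a multiple of the transversal direction [w] gives a direction [u] tangent to
   the zero set. The claim then says that the derivative of [F] along [u] vanishes. *)
have [u uE Phiu] : exists2 u, u = v + (- 'D_v Phi x / b) *: w & 'D_u Phi x = 0.
  eexists; first by [].
  by rewrite deriveDZ ?divfK ?addrN//; exact: dPhi.
suff: 'D_u F x = 0.
  rewrite uE deriveDZ// => /eqP; rewrite addr_eq0 => /eqP ->.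
  by rewrite -mulNr mulrA; congr (_ * _); field.
apply: contrapT => /eqP a0; set a : R := 'D_u F x in a0.
set c : R := 'D_w F x.
have na0 : 0 < `|a| by rewrite normr_gt0.
have nb0 : 0 < `|b| by rewrite normr_gt0.
(* [e] bounds the transversal deviation [t]. Then |t c| is at most |a|/4, so [a + t * c] stays away
   from 0; the denominator is positive even if [c] is 0. *)
pose e := `|a| / (`|a| + 4 * `|c|) : R.
have den0 : 0 < `|a| + 4 * `|c| by rewrite ltr_wpDr// mulr_ge0.
have e0 : 0 < e by rewrite divr_gt0.
have e1 : e <= 1 by rewrite ler_pdivrMr// mul1r lerDl mulr_ge0.
have ec : e * `|c| <= `|a| / 4.
  rewrite mulrAC ler_pdivrMr// -mulrA ler_wpM2l//.
  by rewrite mulrDr mulKf// lerDr mulr_ge0// invr_ge0.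
pose C : R := `|u| + `|w| + 1.
have C0 : 0 < C by rewrite ltr_wpDl// addr_ge0.
(* The tolerance of the linear approximations: the first bound fixes the sign of [Phi] at the ends t
   = -e and t = e, the second keeps the error in [F] below s |a|/4. *)
pose e2 : R := Num.min (e * `|b| / C) (`|a| / (4 * C)).
have e20 : 0 < e2.
  by rewrite lt_min; apply/andP; split; rewrite divr_gt0// mulr_gt0.
have e2b : e2 * C <= e * `|b| by rewrite -ler_pdivlMr// ge_min lexx.
have e2a : e2 * C <= `|a| / 4.
  by rewrite -ler_pdivlMr// -mulrA -invfM ge_min lexx orbT.
have nearD : \forall h \near (0 : V), D (x + h).
  by apply/(nbhs0P D x); exact: open_nbhs_nbhs.
have /nbhs_norm0P[d /= d0 H] : \forall h \near (0 : V), [/\ D (x + h),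
    `|Phi (h + x) - Phi x - 'd Phi x h| <= e2 * `|h| &
    `|F (h + x) - F x - 'd F x h| <= e2 * `|h|].
  have nearP := differentiable_near0 Phi x e2 (dPhi x Dx) e20.
  have nearF := differentiable_near0 F x e2 dF e20.
  apply: filterS3 nearD nearP nearF => h hD hP hF.
  by split; [exact: hD|exact: hP|exact: hF].
have [s s0 sC] : exists2 s : R, 0 < s & s * C < d.
  exists (d / (2 * C)); first by rewrite divr_gt0// mulr_gt0.
  by rewrite invfM mulrA mulfVK ?gt_eqF// ltr_pdivrMr// ltr_pMr// ltr1n.
pose z (t : R) : V := s *: u + t *: (s *: w).
have zle t : `|t| <= e -> `|z t| <= s * C.
  move=> te; rewrite /z scalerA [t * s]mulrC -scalerA -scalerDr normrZ gtr0_norm//.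
  apply: ler_wpM2l; first exact: ltW.
  apply: le_trans (ler_normD _ _) _.
  have : `|t *: w| <= `|w|.
    by rewrite normrZ ler_piMl// (le_trans te).
  by rewrite /C; lra.
have zd t : `|t| <= e -> `|z t| < d.
  by move=> /zle h; exact: le_lt_trans h _.
have dz g t : differentiable g x ->
    'd g x (z t) = s * ('D_u g x + t * 'D_w g x).
  move=> dg; rewrite /z linearD !linearZ/= !deriveE//.
  by rewrite /GRing.scale/=; ring.
have Hz t : `|t| <= e -> [/\ D (z t + x),
    `|Phi (z t + x) - s * t * b| <= s * (e2 * C) &
    `|F (z t + x) - s * (a + t * c)| <= s * (e2 * C)].
  move=> te; have [h1 h2 h3] := H _ (zd _ te); split; first by rewrite addrC.
    move: h2; rewrite Phix subr0 dz; last exact: dPhi.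
    rewrite -/b Phiu add0r mulrA => h2; apply: le_trans h2 _.
    by rewrite mulrCA ler_wpM2l ?(ltW e20)//; exact: zle.
  move: h3; rewrite Fx subr0 dz// -/a -/c => h3; apply: le_trans h3 _.
  by rewrite mulrCA ler_wpM2l ?(ltW e20)//; exact: zle.
have zE t : z t + x = t *: (s *: w) + (s *: u + x).
  by rewrite /z [s *: u + _]addrC -addrA.
(* At t = e and t = -e, [Phi] differs from s e b and - s e b by at most s e |b|, so its values there
   have weakly opposite signs. *)
have [t te Pt] : exists2 t : R, t \in `[- e, e] &
    Phi (t *: (s *: w) + (s *: u + x)) = 0.
  apply: IVT; first by lra.
    apply: derivable_within_continuous => t; rewrite in_itv/= => te.
    have [|? _ _] := Hz t; first by rewrite ler_norml.
    by apply: ex_derive; apply: is_derive_line; rewrite -zE; exact: dPhi.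
  have [|_ hm _] := Hz (- e); first by rewrite normrN gtr0_norm.
  have [|_ hp _] := Hz e; first by rewrite gtr0_norm.
  have sb : s * (e2 * C) <= s * (e * `|b|) by rewrite ler_wpM2l ?(ltW s0).
  rewrite -!zE ge_min le_max.
  have := le_trans hm sb; have := le_trans hp sb; clear -b0 nb0.
  rewrite !ler_norml mulrN mulNr opprK mulrA -[s * e * b]mulrA.
  case: (ltrgt0P b) b0 nb0 => // b0 _ _ /andP[p1 p2] /andP[m1 m2].
    by apply/andP; split; apply/orP; [left|right]; lra.
  by apply/andP; split; apply/orP; [right|left]; lra.
have te' : `|t| <= e by rewrite ler_norml; rewrite in_itv in te.
have [Dt _] := Hz t te'.
rewrite zE in Dt *; have -> : F (t *: (s *: w) + (s *: u + x)) = 0.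
  (* Expanding [u] puts the zero just found in the form for which [PhiF] is assumed. *)
  have E : t *: (s *: w) + (s *: u + x) =
      (t * s + s * (- 'D_v Phi x / b)) *: w + (s *: v + x).
    by rewrite uE scalerDr !scalerA scalerDl -!addrA; congr (_ + _); rewrite addrCA.
  by move: Dt Pt; rewrite E; exact: PhiF.
(* With F = 0 at this point the approximation would give |a + t c| <= e2 C <= |a|/4, whereas |a + t
   c| >= 3|a|/4. *)
apply/negP; rewrite -ltNge sub0r normrN normrM gtr0_norm// ltr_pM2l//.
apply: le_lt_trans e2a _; have := lerB_normD a (t * c).
rewrite normrM; have : `|t| * `|c| <= `|a| / 4.
  by apply: le_trans ec; rewrite ler_wpM2r.
lra.
Qed.

End differentials.

(** * Symmetry of second directional derivatives *)

Section schwarz.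
Context {R : realType} {V : normedModType R}.
Implicit Types (f : V -> R) (x v w : V).

Let second_difference f x v w (s : R) :=
  f (s *: v + (s *: w + x)) - f (s *: v + x) - f (s *: w + x) + f x.

(** The second difference is the increment over [0, s] of t |-> f(t v + s w + x) - f(t v + x). The
    mean value theorem makes it s times a difference of two values of 'D_v f near x, which
    differentiability of 'D_v f at x estimates. *)
Let second_difference_approx f x v w (e : R) :
    (\forall y \near x, differentiable f y) ->
    differentiable ('D_v f) x -> 0 < e ->
  \forall s \near 0^'+,
    `|second_difference f x v w s - s ^+ 2 * 'D_w ('D_v f) x| <= e * s ^+ 2.
Proof.
move=> df dg e0; set g := 'D_v f in dg *.
pose C : R := `|v| + `|w| + 1.
have C0 : 0 < C by rewrite ltr_wpDl// addr_ge0.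
(* Two values of [g] get approximated, each with error at most e' s C; together they cost s e. *)
pose e' : R := e / (2 * C).
have e'0 : 0 < e' by rewrite divr_gt0// mulr_gt0.
have e'C : e' * (2 * C) = e by rewrite mulfVK// gt_eqF// mulr_gt0.
have /nbhs_norm0P[d /= d0 H] : \forall h \near (0 : V),
    differentiable f (x + h) /\
    `|g (h + x) - g x - 'd g x h| <= e' * `|h|.
  near=> h; split; near: h; last exact: differentiable_near0.
  exact: ((nbhs0P (fun y => differentiable f y) x).1 df).
have {}H h : `|h| < d -> differentiable f (h + x) /\
    `|g (h + x) - g x - 'd g x h| <= e' * `|h|.
  by move=> /H; rewrite addrC.
near=> s.
have s0 : 0 < s by near: s; exact: nbhs_right_gt.
have sC : s * C < d.
  rewrite -ltr_pdivlMr//; near: s; apply: nbhs_right_lt; exact: divr_gt0.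
have le1 t : 0 <= t -> t <= s -> `|t *: v| <= s * C.
  move=> t0 ts; rewrite normrZ ger0_norm//; apply: ler_pM => //.
  by rewrite /C -addrA lerDl addr_ge0.
have le2 t : 0 <= t -> t <= s -> `|t *: v + s *: w| <= s * C.
  move=> t0 ts; apply: le_trans (ler_normD _ _) _.
  rewrite !normrZ ger0_norm// (gtr0_norm s0) /C !mulrDr mulr1.
  by rewrite -addrA lerD ?ler_wpM2r// lerDl ltW.
pose phi (t : R) := f (t *: v + (s *: w + x)) - f (t *: v + x).
pose dphi (t : R) := g (t *: v + (s *: w + x)) - g (t *: v + x).
have dphiP t : 0 <= t -> t <= s -> is_derive t 1 phi (dphi t).
  move=> t0 ts; apply: is_deriveB; apply: is_derive_line.
    by rewrite addrA; apply: (H _ _).1; apply: le_lt_trans (le2 _ t0 ts) sC.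
  by apply: (H _ _).1; apply: le_lt_trans (le1 _ t0 ts) sC.
have [||t] := @MVT _ phi dphi 0 s s0.
- by move=> t; rewrite in_itv/= => /andP[t0 ts]; apply: dphiP; exact: ltW.
- apply: derivable_within_continuous => t; rewrite in_itv/= => /andP[t0 ts].
  by have := dphiP _ t0 ts => h; exact: ex_derive.
rewrite in_itv/= => /andP[/ltW t0 /ltW ts].
have -> : phi s - phi 0 = second_difference f x v w s.
  by rewrite /phi /second_difference !scale0r !add0r; ring.
rewrite subr0 => ->.
have [_ h1] := H _ (le_lt_trans (le1 _ t0 ts) sC).
have [_ h2] := H _ (le_lt_trans (le2 _ t0 ts) sC).
have {}h1 := le_trans h1 (ler_wpM2l (ltW e'0) (le1 _ t0 ts)).
have {}h2 := le_trans h2 (ler_wpM2l (ltW e'0) (le2 _ t0 ts)).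
have -> : dphi t * s - s ^+ 2 * 'D_w g x = s * (dphi t - s * 'D_w g x) by ring.
have -> : e * s ^+ 2 = s * (s * e) by ring.
rewrite normrM gtr0_norm// ler_pM2l//.
(* By linearity the contribution of the unknown intermediate point [t] cancels between the two
   differentials. *)
have -> : s * 'D_w g x = 'd g x (t *: v + s *: w) - 'd g x (t *: v).
  by rewrite linearD/= [X in _ = X - _]addrC addrK linearZ/= deriveE.
have -> : s * e = e' * (s * C) + e' * (s * C) by rewrite -e'C; ring.
apply: le_trans (lerD h2 h1); apply: le_trans _ (ler_normB _ _).
rewrite le_eqVlt; apply/orP; left; apply/eqP; congr (`|_|).
by rewrite /dphi addrA; ring.
Unshelve. all: by end_near. Qed.

(** The second difference is symmetric in [v] and [w], and divided by s^2 it approximates both mixed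
    derivatives. *)
Lemma derive_comm f x v w : (\forall y \near x, differentiable f y) ->
    differentiable ('D_v f) x -> differentiable ('D_w f) x ->
  'D_w ('D_v f) x = 'D_v ('D_w f) x.
Proof.
move=> df dv dw; apply/eqP; rewrite -subr_eq0 -normr_le0.
apply/ler_addgt0Pl => e e0; rewrite addr0.
have e20 : 0 < e / 2 by rewrite divr_gt0.
have H1 := @second_difference_approx f x v w _ df dv e20.
have H2 := @second_difference_approx f x w v _ df dw e20.
pose P v w s :=
  `|second_difference f x v w s - s ^+ 2 * 'D_w ('D_v f) x| <= e / 2 * s ^+ 2.
have [s [h1 h2 s_gt0]] : exists s : R, [/\ P v w s, P w v s & 0 < s].
  apply: (@filter_ex R (0 : R)^'+ _ (fun s => [/\ P v w s, P w v s & 0 < s])).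
  apply: filterS3 H1 H2 (nbhs_right_gt (0 : R)) => s h1 h2 s0.
  by split; [exact: h1|exact: h2|exact: s0].
have s0 : 0 < s ^+ 2 by rewrite exprn_gt0.
move: h1 h2; rewrite /P; set a := 'D_w _ _; set b := 'D_v _ _ => h1 h2.
suff : s ^+ 2 * `|a - b| <= s ^+ 2 * e by rewrite ler_pM2l.
rewrite -[X in X * `|_|]gtr0_norm// -normrM.
have -> : s ^+ 2 * e = e / 2 * s ^+ 2 + e / 2 * s ^+ 2 by field.
apply: le_trans (lerD h2 h1); apply: le_trans _ (ler_normB _ _).
rewrite le_eqVlt; apply/orP; left; apply/eqP; congr (`|_|).
by rewrite /second_difference [s *: w + (_ + _)]addrCA; ring.
Qed.

End schwarz.

(** * Closure properties of smooth functions *)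

Section smooth_functions.
Context {R : realType} {n : nat}.
Implicit Types (D : set 'rV[R]_n) (f g : 'rV[R]_n -> R).

(** The differential of [f] serves for [g] too, since the remainder depends only on the germ at
    [x]. *)
Lemma near_eq_differentiable {V : normedModType R} (f g : V -> R) (x : V) :
  (\near x, f x = g x) -> differentiable f x -> differentiable g x.
Proof.
move=> fg df.
have gE : g \o shift x = cst (g x) + 'd f x +o_ (0 : V) id.
  apply/eqaddoP => e e0; near=> h; rewrite !fctE/= -(nbhs_singleton fg).
  have <- : f (h + x) = g (h + x).
    rewrite addrC; near: h; exact: ((nbhs0P (fun y => f y = g y) x).1 fg).
  by rewrite opprD addrA; near: h; exact: differentiable_near0.
apply/diff_locallyP; have dfc := diff_continuous df.
by rewrite (diff_unique dfc gE).
Unshelve. all: by end_near. Qed.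

Lemma eq_partial D f g i x : open D -> D x -> (forall y, D y -> f y = g y) ->
  partial i f x = partial i g x.
Proof.
move=> oD Dx fg; apply: near_eq_derive.
by apply: filterS (open_nbhs_nbhs (conj oD Dx)).
Qed.

(** This replaces an induction on iterated derivatives for each kind of function: it is enough to
    find a class of differentiable functions closed under [partial]. Closure is asked only up to
    equality on [D], because the rules of calculus hold only there. *)
Lemma smooth_on_stable D (S : ('rV[R]_n -> R) -> Prop) : open D ->
    (forall f x, S f -> D x -> differentiable f x) ->
    (forall f i, S f -> exists2 g, S g & forall x, D x -> partial i f x = g x) ->
  forall f, S f -> smooth_on D f.
Proof.
move=> oD dS pS f Sf s x Dx.
suff [g Sg fg] : exists2 g, S g & forall y, D y -> iter_partial s f y = g y.
  apply: near_eq_differentiable (dS _ _ Sg Dx).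
  by apply: filterS (open_nbhs_nbhs (conj oD Dx)) => y /fg.
elim: s {x Dx} => [|i s [g Sg fg]]; first by exists f.
have [h Sh gh] := pS g i Sg; exists h => // y Dy /=.
by rewrite -gh//; exact: eq_partial fg.
Qed.

Lemma smooth_on_differentiable D f x :
  smooth_on D f -> D x -> differentiable f x.
Proof. by move=> sf; exact: (sf [::]). Qed.

Lemma smooth_on_partial D f i : smooth_on D f -> smooth_on D (partial i f).
Proof.
(* [foldr] applies the last index of the sequence first. *)
move=> sf s x Dx; have := sf (rcons s i) x Dx.
by rewrite /iter_partial foldr_rcons.
Qed.

Lemma smooth_on_cst D (c : R) : open D -> smooth_on D (cst c).
Proof.
move=> oD; apply: (@smooth_on_stable _ (range cst)) => //.
  by move=> _ x [b _ <-] _; exact: differentiable_cst.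
by move=> _ i [b _ <-]; exists (cst 0) => [|x _]; [exists 0|exact: derive_cst].
Qed.

Lemma derive_coord m (i : 'I_m) (j : 'I_n) (x v : 'M[R]_(m, n)) :
  'D_v (fun y : 'M[R]_(m, n) => y i j) x = v i j.
Proof.
apply/cvg_lim => //; apply: cvg_near_cst.
near=> h; rewrite [(_ \o _) _]/= !mxE addrK /GRing.scale/= mulKf//.
by near: h; exact: nbhs_dnbhs_neq.
Unshelve. all: by end_near. Qed.

Lemma smooth_on_coord D (j : 'I_n) : open D -> smooth_on D (fun x => x 0 j).
Proof.
move=> oD; pose S f := f = (fun x : 'rV[R]_n => x 0 j) \/ range cst f.
apply: (@smooth_on_stable _ S) => //; last by left.
  move=> _ x [->|[b _ <-]] _; first exact: differentiable_coord.
  exact: differentiable_cst.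
move=> _ i [->|[b _ <-]]; last first.
  by exists (cst 0) => [|x _]; [right; exists 0|exact: derive_cst].
exists (cst ((delta_mx 0 i : 'rV[R]_n) 0 j)) => [|x _]; first by right; eexists.
exact: derive_coord.
Qed.

(** By the Leibniz rule a partial derivative of a product is a sum of products, so sums and products
    have to be closed up together before [smooth_on_stable] applies. *)
Inductive ring_closure (S : ('rV[R]_n -> R) -> Prop) :
    ('rV[R]_n -> R) -> Prop :=
| ring_closure_mem f : S f -> ring_closure S f
| ring_closureD f g : ring_closure S f -> ring_closure S g ->
    ring_closure S (fun x => f x + g x)
| ring_closureM f g : ring_closure S f -> ring_closure S g ->
    ring_closure S (fun x => f x * g x).

Lemma smooth_on_ring_closure D f : open D ->
  ring_closure (smooth_on D) f -> smooth_on D f.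
Proof.
move=> oD.
have dS g x : ring_closure (smooth_on D) g -> D x -> differentiable g x.
  elim=> {g} [g sg|g h _ dg _ dh|g h _ dg _ dh] Dx.
  - exact: smooth_on_differentiable sg Dx.
  - by apply: differentiableD; [exact: dg|exact: dh].
  - by apply: differentiableM; [exact: dg|exact: dh].
apply: smooth_on_stable => // {}f i.
elim=> {f} [g sg|g h Sg [g' Sg' gg'] Sh [h' Sh' hh']|
            g h Sg [g' Sg' gg'] Sh [h' Sh' hh']].
- exists (partial i g) => //; apply: ring_closure_mem; exact: smooth_on_partial.
- exists (fun x => g' x + h' x); first exact: ring_closureD.
  move=> x Dx; rewrite -gg'// -hh'// /partial -deriveD//;
    by apply: diff_derivable; exact: dS.
- exists (fun x => g x * h' x + h x * g' x).
    by apply: ring_closureD; exact: ring_closureM.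
  move=> x Dx; rewrite -gg'// -hh'// /partial -deriveM//;
    by apply: diff_derivable; exact: dS.
Qed.

Lemma smooth_onD D f g : open D -> smooth_on D f -> smooth_on D g ->
  smooth_on D (fun x => f x + g x).
Proof.
move=> oD sf sg; apply: smooth_on_ring_closure => //.
by apply: ring_closureD; exact: ring_closure_mem.
Qed.

Lemma smooth_onM D f g : open D -> smooth_on D f -> smooth_on D g ->
  smooth_on D (fun x => f x * g x).
Proof.
move=> oD sf sg; apply: smooth_on_ring_closure => //.
by apply: ring_closureM; exact: ring_closure_mem.
Qed.

Lemma partial_comm D f i j x : open D -> smooth_on D f -> D x ->
  partial i (partial j f) x = partial j (partial i f) x.
Proof.
move=> oD sf Dx; apply: derive_comm.
- apply: filterS (open_nbhs_nbhs (conj oD Dx)) => y.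
  exact: smooth_on_differentiable.
- exact: (smooth_on_partial D f j sf [::] x Dx).
- exact: (smooth_on_partial D f i sf [::] x Dx).
Qed.

End smooth_functions.

(** * The projection of the jet space to the (u1, u2)-plane *)

Section jet_projection.
Context {R : realType}.
Implicit Types (g : 'rV[R]_2 -> R) (J v : 'rV[R]_6).

Lemma jet_uD J v (h : R) : jet_u (h *: v + J) = h *: jet_u v + jet_u J.
Proof.
by apply/rowP => j; rewrite !mxE/=; case: j => [[|[|//]] ?]; rewrite /= ?mxE.
Qed.

Lemma differentiable_jet_u J : differentiable (@jet_u R) J.
Proof.
have -> : @jet_u R = (fun J : 'rV[R]_6 =>
    J 0 j_u1 *: delta_mx 0 i_u1 + J 0 j_u2 *: delta_mx 0 i_u2).
  apply/funext => K; apply/rowP => j; rewrite !mxE/=.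
  by case: j => [[|[|//]] ?] /=; rewrite ?mulr0 ?mulr1 ?addr0 ?add0r.
apply: differentiableD; apply: differentiableZl; exact: differentiable_coord.
Qed.

Lemma open_jet_u_preimage (Omega : set 'rV[R]_2) :
  open Omega -> open (@jet_u R @^-1` Omega).
Proof.
move=> oO; apply: open_comp => // J _.
exact/differentiable_continuous/differentiable_jet_u.
Qed.

Lemma derive_comp_jet_u g J v :
  'D_v (fun J => g (jet_u J)) J = 'D_(jet_u v) g (jet_u J).
Proof.
rewrite /derive; set a := (fun _ => _); set b := (fun _ => _).
suff -> : a = b by [].
by apply/funext => h; rewrite /a /b/= jet_uD.
Qed.

Lemma jet_u_delta i : @jet_u R (delta_mx 0 i) =
  if i == j_u1 then delta_mx 0 i_u1
  else if i == j_u2 then delta_mx 0 i_u2 else 0.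
Proof.
apply/rowP => j; case: i => [[|[|[|[|[|[|//]]]]]] ?]; rewrite /= !mxE/=;
  by case: j => [[|[|//]] ?]/=; rewrite ?mxE/=.
Qed.

(** Since [jet_u] is linear, a partial derivative of a pullback is the pullback of a derivative in
    the constant direction [jet_u (delta_mx 0 i)], which is a basis vector or 0. Pullbacks of smooth
    functions thus form a stable class. *)
Lemma smooth_on_comp_jet_u (Omega : set 'rV[R]_2) g :
    open Omega -> smooth_on Omega g ->
  smooth_on (@jet_u R @^-1` Omega) (fun J => g (jet_u J)).
Proof.
move=> oO sg.
pose S f := exists2 h, smooth_on Omega h & f = (fun J => h (@jet_u R J)).
have oD := open_jet_u_preimage _ oO.
apply: (@smooth_on_stable _ _ _ S) => //; last by exists g.
  move=> _ J [h sh ->] OJ; apply: (@differentiable_comp _ _ _ _ (@jet_u R) h).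
    exact: differentiable_jet_u.
  exact: smooth_on_differentiable sh OJ.
move=> _ i [h sh ->].
exists (fun J => 'D_(jet_u (delta_mx 0 i)) h (jet_u J)); last first.
  by move=> J _; exact: derive_comp_jet_u.
exists ('D_(jet_u (delta_mx 0 i)) h) => //; rewrite jet_u_delta.
case: ifP => _; [exact: smooth_on_partial|case: ifP => _].
  exact: smooth_on_partial.
rewrite (_ : 'D_0 h = cst 0); first exact: smooth_on_cst.
by apply/funext => x; rewrite derive0.
Qed.

End jet_projection.

(** * Linear degeneracy of a Jordan block *)

Lemma charcoef_jordan1 {R : realType} (lam mu : 'rV[R]_2 -> R) :
  charcoef (jordan_system lam mu) 1 = (fun u => - (2 * lam u)).
Proof.
apply/funext => u; rewrite /charcoef -[(2 - 1)%N]/(2.-1) char_poly_trace//.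
by rewrite /mxtrace 2!big_ord_recl big_ord0 !mxE/= addr0 mulrDl mul1r.
Qed.

Lemma charcoef_jordan2 {R : realType} (lam mu : 'rV[R]_2 -> R) :
  charcoef (jordan_system lam mu) 2 = (fun u => lam u * lam u).
Proof.
apply/funext => u; rewrite /charcoef subnn char_poly_det (expand_det_row _ i_u2).
rewrite 2!big_ord_recl big_ord0 /cofactor !det_mx11 !mxE/=.
by rewrite /bump/=; ring.
Qed.

(** With f_1 = -2 lam and f_2 = lam^2 the sum is -2 grad(lam) (A - lam I). The only nonzero entry of
    A - lam I is [mu], in the upper right corner, which leaves the row (0, -2 mu lam_u1). *)
Lemma linearly_degenerate_jordanE {R : realType} (Omega : set 'rV[R]_2)
    (lam mu : 'rV[R]_2 -> R) :
    (forall u, Omega u -> differentiable lam u) ->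
    (forall u, Omega u -> mu u != 0) ->
  linearly_degenerate Omega (jordan_system lam mu) <->
  forall u, Omega u -> partial i_u1 lam u = 0.
Proof.
move=> dlam mu0.
have E u : Omega u ->
    \sum_(1 <= k < 3) gradient (charcoef (jordan_system lam mu) k) u
                        *m jordan_system lam mu u ^+ (2 - k)
    = \row_j (if j == i_u2 then - (2 * mu u * partial i_u1 lam u) else 0).
  move=> Ou; have dl i : derivable lam u (delta_mx 0 i).
    by apply: diff_derivable; exact: dlam.
  rewrite big_ltn// big_ltn// big_geq// addr0 charcoef_jordan1 charcoef_jordan2.
  rewrite expr1 expr0 mulmx1.
  have G1 i : gradient (fun u => - (2 * lam u)) u 0 i = - (2 * partial i lam u).
    rewrite mxE /partial deriveN; last exact: derivableM.
    by rewrite deriveM// derive_cst; congr (- _); rewrite /GRing.scale/= mulr0 addr0.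
  have G2 i : gradient (fun u => lam u * lam u) u 0 i
      = 2 * lam u * partial i lam u.
    by rewrite mxE /partial deriveM// /GRing.scale/=; ring.
  apply/rowP => j; rewrite mxE [RHS]mxE [X in _ + X]G2 mxE !big_ord_recl big_ord0.
  rewrite !G1 !mxE/=.
  case: j => [[|[|//]] jlt]/=.
    have -> : Ordinal jlt = i_u1 by exact: val_inj.
    have -> : ord0 = i_u1 by exact: val_inj.
    by rewrite /=; ring.
  have -> : Ordinal jlt = i_u2 by exact: val_inj.
  have -> : ord0 = i_u1 by exact: val_inj.
  have -> : lift i_u1 (ord0 : 'I_1) = i_u2 by exact: val_inj.
  by rewrite /=; ring.
split=> [LD u Ou|H u Ou].
  have /rowP/(_ i_u2) := LD _ Ou; rewrite E// !mxE/= => /eqP.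
  rewrite oppr_eq0 !mulf_eq0 pnatr_eq0/= (negbTE (mu0 _ Ou)) => /eqP//.
by rewrite E//; apply/rowP => j; rewrite !mxE H// mulr0 oppr0 if_same.
Qed.

(** * Rank and solvability of the second-order system *)

Lemma forall_ord6 (P : 'I_6 -> Prop) :
  P j_x -> P j_t -> P j_u1 -> P j_u2 -> P j_p -> P j_q -> forall i, P i.
Proof.
move=> P0 P1 P2 P3 P4 P5 i.
have : i \in [:: j_x; j_t; j_u1; j_u2; j_p; j_q].
  by case: i => [[|[|[|[|[|[|//]]]]]] ?].
by rewrite !inE => /or4P[|||/or3P[]] /eqP ->.
Qed.

Lemma sum_ord6 {V : nmodType} (F : 'I_6 -> V) :
  \sum_i F i = F j_x + F j_t + F j_u1 + F j_u2 + F j_p + F j_q.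
Proof.
rewrite 6!big_ord_recl big_ord0 addr0 !addrA.
by do ![congr (_ + _)|congr (F _)]; exact: val_inj.
Qed.

Section compatibility.
Context {R : realType}.
Variables (lam mu : 'rV[R]_2 -> R) (Phi : 'rV[R]_6 -> R).
Implicit Type J : 'rV[R]_6.

(** Here [j_x], ..., [j_q] are mere names of the positions 0 to 5: the entries of [y] are
    multipliers of the six equations. *)
Lemma second_order_mx_row_mulE J (y : 'rV[R]_6) :
  y *m second_order_mx lam mu Phi J =
  let l := lam (jet_u J) in
  let m := mu (jet_u J) in
  let Pp := partial j_p Phi J in
  let Pq := partial j_q Phi J in
  mx_of_rows 1 6 [:: [::
    y 0 j_x * Pp - l * y 0 j_u1;
    y 0 j_t * Pp + y 0 j_u1 - l * y 0 j_u2;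
    y 0 j_u2;
    y 0 j_x * Pq - m * y 0 j_u1 - l * y 0 j_p;
    y 0 j_t * Pq - m * y 0 j_u2 + y 0 j_p - l * y 0 j_q;
    y 0 j_q]].
Proof.
apply/rowP => j; rewrite mxE sum_ord6.
rewrite !mxE/=; move: (lam _) (mu _) (partial j_p Phi J) (partial j_q Phi J).
move: (y 0 j_x) (y 0 j_t) (y 0 j_u1) (y 0 j_u2) (y 0 j_p) (y 0 j_q).
move=> y0 y1 y2 y3 y4 y5 l m Pp Pq.
by case: j => [[|[|[|[|[|[|//]]]]]] jlt]/=; ring.
Qed.

(** The entries of [y] at [j_x], ..., [j_q] are the unknowns u1_xx, u1_xt, u1_tt, u2_xx, u2_xt,
    u2_tt in this order. *)
Lemma second_order_mx_mulE J (y : 'cV[R]_6) :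
  second_order_mx lam mu Phi J *m y =
  let l := lam (jet_u J) in
  let m := mu (jet_u J) in
  let Pp := partial j_p Phi J in
  let Pq := partial j_q Phi J in
  mx_of_rows 6 1 [::
    [:: Pp * y j_x 0 + Pq * y j_u2 0];
    [:: Pp * y j_t 0 + Pq * y j_p 0];
    [:: y j_t 0 - l * y j_x 0 - m * y j_u2 0];
    [:: y j_u1 0 - l * y j_t 0 - m * y j_p 0];
    [:: y j_p 0 - l * y j_u2 0];
    [:: y j_q 0 - l * y j_p 0]].
Proof.
apply/colP => j; rewrite mxE sum_ord6.
rewrite !mxE/=; move: (lam _) (mu _) (partial j_p Phi J) (partial j_q Phi J).
move: (y j_x 0) (y j_t 0) (y j_u1 0) (y j_u2 0) (y j_p 0) (y j_q 0).
move=> y0 y1 y2 y3 y4 y5 l m Pp Pq.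
by case: j => [[|[|[|[|[|[|//]]]]]] jlt]/=; ring.
Qed.

(* If Phi_p = 0, the combination - lam * row_0 + row_1 - Phi_q * row_4 of the
   rows of the second-order system vanishes; the defect is, up to sign, the same
   combination of the right-hand sides. *)
Definition compatibility_defect J : R :=
  partial j_t Phi J - lam (jet_u J) * partial j_x Phi J
  + mu (jet_u J) * J 0 j_q * partial j_u1 Phi J
  + partial j_q Phi J * dx_of lam J * J 0 j_q.

(** Eliminating the t-derivatives leaves two equations in u1_xx and u2_xx with determinant mu
    Phi_p^2. The proof finds the same dichotomy in the left kernel. *)
Lemma rank_second_order_mx J : mu (jet_u J) != 0 ->
  (\rank (second_order_mx lam mu Phi J) < 6)%N <-> partial j_p Phi J = 0.
Proof.
move=> m0; split=> [|Pp0].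
  apply: contraTeq => P0; rewrite -leqNgt.
  suff : row_free (second_order_mx lam mu Phi J) by rewrite row_leq_rank.
  rewrite -kermx_eq0; apply/rowV0P => v /sub_kermxP.
  rewrite second_order_mx_row_mulE.
  move: (lam _) (mu _) (partial j_p Phi J) (partial j_q Phi J) m0 P0.
  move=> l m Pp Pq m0 P0 /rowP vM; apply/rowP.
  move: (vM j_x) (vM j_t) (vM j_u1) (vM j_u2) (vM j_p) (vM j_q).
  rewrite !mxE/= => e0 e1 e2 e3 e4 e5.
  rewrite e2 e5 in e1 e4.
  have v2 : v 0 j_u1 = - (v 0 j_t * Pp).
    by rewrite -[LHS]subr0 -e1; ring.
  have v4 : v 0 j_p = - (v 0 j_t * Pq).
    by rewrite -[LHS]subr0 -e4; ring.
  have v0 : v 0 j_x = - (v 0 j_t * l).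
    by apply: (mulIf P0); rewrite -[LHS]subr0 -e0 v2; ring.
  (* After substitution the u2_xx column reads v_1 mu Phi_p = 0. *)
  have v1 : v 0 j_t = 0.
    by apply: (mulIf m0); apply: (mulIf P0); rewrite !mul0r -e3 v0 v2 v4; ring.
  by apply: forall_ord6; rewrite mxE ?v0 ?v2 ?v4 ?v1 ?mul0r ?oppr0.
pose v : 'rV[R]_6 :=
  \row_j [:: - lam (jet_u J); 1; 0; 0; - partial j_q Phi J; 0]`_j.
have v0 : v != 0 by apply/eqP => /rowP/(_ j_t)/eqP; rewrite !mxE/= oner_eq0.
have vM : v *m second_order_mx lam mu Phi J = 0.
  rewrite second_order_mx_row_mulE Pp0 /v; apply/rowP.
  move: (lam _) (mu _) (partial j_q Phi J) => l m Pq.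
  by apply: forall_ord6; rewrite !mxE/= ?mxE/=; ring.
rewrite ltn_neqAle rank_leq_row andbT; apply: contra v0 => /row_freeP[B MB].
by rewrite -[v]mulmx1 -MB mulmxA vM mul0mx.
Qed.

(** When Phi_p = 0, the x-derivative of the constraint determines u2_xx, the system then yields the
    other unknowns from a free u1_xx, and the t-derivative of the constraint is left as the only
    condition. *)
Lemma second_order_system_solvable J :
    partial j_p Phi J = 0 -> partial j_q Phi J != 0 ->
  (exists y, second_order_mx lam mu Phi J *m y = second_order_rhs lam mu Phi J)
  <-> compatibility_defect J = 0.
Proof.
move=> Pp0 Pq0; rewrite /compatibility_defect.
have E y : second_order_mx lam mu Phi J *m y = second_order_rhs lam mu Phi J <->
  forall i, (second_order_mx lam mu Phi J *m y) i 0
      = second_order_rhs lam mu Phi J i 0.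
  by split=> [->//|H]; apply/colP.
under eq_exists do rewrite (propext (E _)).
under eq_exists do rewrite second_order_mx_mulE.
rewrite /second_order_rhs Pp0 /u1_t /u2_t {E}.
move: (dx_of lam J) (dt_of lam mu lam J) (dx_of mu J) (dt_of lam mu mu J).
move=> lx lt mx mt.
move: (lam _) (mu _) (J 0 j_p) (J 0 j_q) => l m p q.
move: (partial j_q Phi J) Pq0 (partial j_x Phi J) (partial j_t Phi J) => Pq Pq0.
move: (partial j_u1 Phi J) (partial j_u2 Phi J) => P1 P2 Px Pt.
split=> [[y My]|def0].
  move: (My j_x) (My j_t) (My j_p); rewrite !mxE/= !mul0r !add0r => e0 e1 e4.
  have -> : Px = - (Pq * y j_u2 0 + P1 * p + P2 * q) by rewrite e0; ring.
  have -> : Pt = - (Pq * y j_p 0 + P1 * (l * p + m * q) + P2 * (l * q)).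
    by rewrite e1; ring.
  by rewrite -[Pq * lx * q]mulrA -e4; ring.
(* [y3] is u2_xx, solved from the x-derivative of the constraint; the free unknown u1_xx is set to
   0. *)
pose y3 := - (Px + P1 * p + P2 * q) / Pq.
pose y4 := lx * q + l * y3.
pose y1 := lx * p + mx * q + m * y3.
pose y2 := lt * p + mt * q + l * y1 + m * y4.
exists (\col_i [:: 0; y1; y2; y3; y4; lt * q + l * y4]`_i).
have y3E : Pq * y3 = - (Px + P1 * p + P2 * q) by rewrite mulrC divfK.
apply: forall_ord6; rewrite !mxE/= ?mxE/=.
- by rewrite mul0r add0r.
- have -> : Pq * y4 = Pq * (lx * q) + l * (Pq * y3) by rewrite /y4; ring.
  by rewrite y3E mul0r add0r -[RHS]addr0 -def0; ring.
- by rewrite /y1; ring.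
- by rewrite /y2; ring.
- by rewrite /y4; ring.
- by ring.
Qed.

End compatibility.

(** * Sufficiency: an explicit constraint when lam_u1 = 0 *)

Section sufficiency.
Context {R : realType}.
Variable g : 'rV[R]_2 -> R.
Implicit Types J v : 'rV[R]_6.

(** If lam_u1 = 0 and g = lam_u2, then u2 and g are constant along the characteristics dx/dt = -
    lam, and 1/q + t g is conserved; the constraint sets it to 1. Subtractions are written with the
    constant -1 so that [smooth_onD] and [smooth_onM] apply directly. *)
Definition reciprocal_constraint J : R :=
  J 0 j_q * (1 + -1 * (J 0 j_t * g (jet_u J))) + -1.

Lemma smooth_on_reciprocal_constraint (Omega : set 'rV[R]_2) :
    open Omega -> smooth_on Omega g ->
  smooth_on (@jet_u R @^-1` Omega) reciprocal_constraint.
Proof.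
move=> oO sg; have oD := open_jet_u_preimage _ oO; rewrite /reciprocal_constraint.
apply: smooth_onD; [exact: oD| |exact: smooth_on_cst].
apply: smooth_onM; [exact: oD|exact: smooth_on_coord|].
apply: smooth_onD; [exact: oD|exact: smooth_on_cst|].
apply: smooth_onM; [exact: oD|exact: smooth_on_cst|].
apply: smooth_onM; [exact: oD|exact: smooth_on_coord|].
exact: smooth_on_comp_jet_u.
Qed.

Lemma derive_reciprocal_constraint J v : differentiable g (jet_u J) ->
  'D_v reciprocal_constraint J = v 0 j_q * (1 - J 0 j_t * g (jet_u J))
    - J 0 j_q * (v 0 j_t * g (jet_u J) + J 0 j_t * 'D_(jet_u v) g (jet_u J)).
Proof.
move=> dg.
have [dq dqE] : is_derive J v (fun J => J 0 j_q : R) (v 0 j_q).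
  by split; [exact/diff_derivable/differentiable_coord|exact: derive_coord].
have [dt dtE] : is_derive J v (fun J => J 0 j_t : R) (v 0 j_t).
  by split; [exact/diff_derivable/differentiable_coord|exact: derive_coord].
have [dG dGE] : is_derive J v (fun J => g (jet_u J)) ('D_(jet_u v) g (jet_u J)).
  split; last exact: derive_comp_jet_u.
  apply: diff_derivable; apply: (differentiable_comp (f := @jet_u R)) => //.
  exact: differentiable_jet_u.
have dtG := derivableM dt dG.
have d1 := derivable_cst (1 : R) J v.
have dm := derivable_cst (-1 : R) J v.
have dmtG := derivableM dm dtG.
have d1mtG := derivableD d1 dmtG.
rewrite /reciprocal_constraint.
rewrite (deriveD (derivableM dq d1mtG) dm) (deriveM dq d1mtG) (deriveD d1 dmtG).
rewrite (deriveM dm dtG) (deriveM dt dG) !derive_cst dqE dtE dGE.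
rewrite !fctE /GRing.scale/=.
move: ('D_(jet_u v) g _) (g (jet_u J)) (J 0 j_q) (J 0 j_t) (v 0 j_q) (v 0 j_t).
by move=> a b c d e f; ring.
Qed.

End sufficiency.

Lemma admits_differential_constraint_of_partial_eq0 {R : realType}
    (Omega : set 'rV[R]_2) (lam mu : 'rV[R]_2 -> R) :
    open Omega -> smooth_on Omega lam -> (forall u, Omega u -> mu u != 0) ->
    (forall u, Omega u -> partial i_u1 lam u = 0) ->
  admits_differential_constraint Omega lam mu.
Proof.
move=> oO slam mu0 lam1.
have sg := smooth_on_partial _ _ i_u2 slam.
have oD := open_jet_u_preimage _ oO.
(* Symmetry of second derivatives turns lam_u1 = 0 into g_u1 = 0, which removes Phi_u1 from the
   defect. *)
have lam21 u : Omega u -> partial i_u1 (partial i_u2 lam) u = 0.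
  move=> Ou; rewrite (partial_comm Omega)//.
  rewrite (eq_partial Omega _ (cst 0))//; exact: derive_cst.
set g := partial i_u2 lam in sg lam21.
exists (@jet_u R @^-1` Omega), (reciprocal_constraint g).
have dPhi J v : Omega (jet_u J) -> 'D_v (reciprocal_constraint g) J
    = v 0 j_q * (1 - J 0 j_t * g (jet_u J))
    - J 0 j_q * (v 0 j_t * g (jet_u J) + J 0 j_t * 'D_(jet_u v) g (jet_u J)).
  move=> OJ; apply: derive_reciprocal_constraint.
  exact: smooth_on_differentiable sg OJ.
have Phiq J : Omega (jet_u J) ->
    partial j_q (reciprocal_constraint g) J = 1 - J 0 j_t * g (jet_u J).
  move=> OJ; rewrite /partial dPhi// jet_u_delta/= derive0 !mxE/=.
  by rewrite mul0r mulr0 addr0 mulr0 subr0 mul1r.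
have Phiq0 J : Omega (jet_u J) -> reciprocal_constraint g J = 0 ->
    J 0 j_q * partial j_q (reciprocal_constraint g) J = 1.
  by move=> OJ PJ; rewrite Phiq// -[RHS]add0r -PJ /reciprocal_constraint; ring.
have PhiqN0 J : Omega (jet_u J) -> reciprocal_constraint g J = 0 ->
    partial j_q (reciprocal_constraint g) J != 0.
  move=> OJ /(Phiq0 _ OJ) e; apply/eqP => e0.
  by move: e; rewrite e0 mulr0 => /esym/eqP; rewrite oner_eq0.
split.
- by split=> //; exact: smooth_on_reciprocal_constraint.
- by move=> J OJ PJ; right; exact: PhiqN0.
(* At t = 0 the constraint reads q = 1, whatever u is. *)
- move=> u Ou; exists (\row_j [:: 0; 0; u 0 i_u1; u 0 i_u2; 0; 1]`_j).
  have uE : jet_u (\row_j [:: 0; 0; u 0 i_u1; u 0 i_u2; 0; 1]`_j) = u.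
    apply/rowP => j; rewrite !mxE/=; case: j => [[|[|//]] jlt]/=; rewrite ?mxE/=;
      by congr (u _ _); exact: val_inj.
  split=> //; rewrite /= ?uE//; last by rewrite mxE/= oner_neq0.
  by rewrite /reciprocal_constraint !mxE/=; ring.
- move=> J OJ PJ.
  have Phip : partial j_p (reciprocal_constraint g) J = 0.
    rewrite /partial dPhi// jet_u_delta/= derive0 !mxE/=.
    by rewrite !mul0r mulr0 addr0 mulr0 subr0.
  split; first by apply/rank_second_order_mx; [exact: mu0|].
  apply/second_order_system_solvable => //; first exact: PhiqN0.
  rewrite /compatibility_defect /dx_of lam1// mul0r add0r -/g.
  have Phit : partial j_t (reciprocal_constraint g) J = - (J 0 j_q * g (jet_u J)).
    rewrite /partial dPhi// jet_u_delta/= derive0 !mxE/=.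
    by rewrite mulr0 addr0 mul0r sub0r mul1r.
  have Phix : partial j_x (reciprocal_constraint g) J = 0.
    rewrite /partial dPhi// jet_u_delta/= derive0 !mxE/=.
    by rewrite !mul0r mulr0 addr0 mulr0 subr0.
  have Phiu1 : partial j_u1 (reciprocal_constraint g) J = 0.
    have dg0 : 'D_(delta_mx 0 i_u1) g (jet_u J) = 0 := lam21 _ OJ.
    rewrite /partial dPhi// jet_u_delta/= dg0 !mxE/=.
    by rewrite !mul0r mulr0 addr0 mulr0 subr0.
  (* The defect is now g q (q Phi_q - 1), and q Phi_q = 1 on the constraint. *)
  rewrite Phit Phix Phiu1 !mulr0 subr0 addr0.
  move: (Phiq0 J OJ PJ); move: (partial j_q _ J) (g _) (J 0 j_q) => P a q qP.
  have -> : P * (a * q) * q = q * P * (q * a) by ring.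
  by rewrite qP mul1r addNr.
Qed.

(** * Necessity: eliminating the second derivatives of the constraint *)

Lemma is_derive_frozen_defect {R : realType} {V : normedModType R}
    (f1 f2 f3 f4 P Q : V -> R) (l m l1 l2 : R) (x v : V) (a1 a2 a3 a4 : R) :
    is_derive x v f1 a1 -> is_derive x v f2 a2 -> is_derive x v f3 a3 ->
    is_derive x v f4 a4 -> is_derive x v P 1 -> is_derive x v Q 0 ->
  is_derive x v (f1 + cst (- l) * f2 + cst m * (Q * f3)
    + f4 * ((cst l1 * P + cst l2 * Q) * Q))
    (a1 - l * a2 + m * (Q x * a3)
     + (a4 * ((l1 * P x + l2 * Q x) * Q x) + f4 x * (l1 * Q x))).
Proof.
move=> d1 d2 d3 d4 dP dQ.
have dc (k : R) : is_derive x v (cst k : V -> R) 0 by exact: is_derive_cst.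
have e1 := is_deriveM (dc (- l)) d2.
have e2 := is_deriveM (dc m) (is_deriveM dQ d3).
(* [P] and [Q] stand for the coordinates p and q and [v] for the direction of p, so that l1 P + l2 Q
   has derivative l1. *)
have e3 := is_deriveD (is_deriveM (dc l1) dP) (is_deriveM (dc l2) dQ).
have e4 := is_deriveM d4 (is_deriveM e3 dQ).
apply: is_derive_eq (is_deriveD (is_deriveD (is_deriveD d1 e1) e2) e4) _.
by rewrite !fctE /GRing.scale/=; ring.
Qed.

Lemma frozen_defectE {R : comRingType} (Pt Px P1 Pq p q l m l1 l2 : R) :
  Pt + (- l) * Px + m * (q * P1) + Pq * ((l1 * p + l2 * q) * q)
  = Pt - l * Px + m * q * P1 + Pq * (l1 * p + l2 * q) * q.
Proof. by ring. Qed.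

(** [at_], [ax], [a1], [aq] are the derivatives of Phi_p in t, x, u1, q. Put X = (l1 p + l2 q) q.
    The vanishing defect turns the second equation into at_ - l ax + m q a1 = - X aq; in the third
    the terms in X then cancel, leaving Pq l1 q = 0. *)
Lemma defect_elimination {R : fieldType}
    (Pt Px P1 Pq at_ ax a1 aq p q l m l1 l2 : R) : Pq != 0 -> q != 0 ->
    Pt - l * Px + m * q * P1 + Pq * (l1 * p + l2 * q) * q = 0 ->
    Pq * (at_ - l * ax + m * q * a1) = (Pt - l * Px + m * q * P1) * aq ->
    at_ - l * ax + m * (q * a1) + (aq * ((l1 * p + l2 * q) * q) + Pq * (l1 * q))
      = 0 ->
  l1 = 0.
Proof.
move=> Pq0 q0 /eqP; rewrite addr_eq0 => /eqP -> T1 T2.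
apply: (mulIf q0); apply: (mulfI Pq0); apply: (mulfI Pq0).
rewrite mul0r !mulr0 -[RHS](mulr0 Pq) -T2.
have -> : Pq * (at_ - l * ax + m * (q * a1) +
    (aq * ((l1 * p + l2 * q) * q) + Pq * (l1 * q))) =
  Pq * (at_ - l * ax + m * q * a1) +
    Pq * (aq * ((l1 * p + l2 * q) * q) + Pq * (l1 * q)) by ring.
by rewrite T1; ring.
Qed.

Lemma partial_eq0_of_admits {R : realType} (Omega : set 'rV[R]_2)
    (lam mu : 'rV[R]_2 -> R) : (forall u, Omega u -> mu u != 0) ->
    admits_differential_constraint Omega lam mu ->
  forall u, Omega u -> partial i_u1 lam u = 0.
Proof.
move=> mu0 [D [Phi [[oD DO sPhi] foc ntc cmp]]] u Ou.
have [J0 [DJ0 uJ0 PJ0 q0]] := ntc u Ou.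
have dPhi J : D J -> differentiable Phi J by exact: smooth_on_differentiable sPhi.
have dpPhi i J : D J -> differentiable (partial i Phi) J.
  exact: smooth_on_differentiable (smooth_on_partial _ _ i sPhi).
have onZ J : D J -> Phi J = 0 -> [/\ partial j_p Phi J = 0,
    partial j_q Phi J != 0 & compatibility_defect lam mu Phi J = 0].
  move=> DJ PJ; have [rk sol] := cmp J DJ PJ.
  have Pp : partial j_p Phi J = 0.
    exact: (rank_second_order_mx lam mu Phi J (mu0 _ (DO _ DJ))).1 rk.
  have Pq : partial j_q Phi J != 0 by case: (foc J DJ PJ); rewrite ?Pp ?eqxx.
  by split=> //; exact: (second_order_system_solvable lam mu Phi J Pp Pq).1 sol.
have [Pp0 Pq0 def0] := onZ J0 DJ0 PJ0.
pose l := lam u; pose m := mu u; pose q := J0 0 j_q; pose p := J0 0 j_p.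
pose l1 := partial i_u1 lam u; pose l2 := partial i_u2 lam u.
pose e i : 'rV[R]_6 := delta_mx 0 i.
(* The coefficients are frozen at [J0], so [w] is a fixed vector, and 'D_w Phi J0 collects the terms
   of the defect at [J0] other than the one with Phi_q. *)
pose w := (e j_t + (- l) *: e j_x) + (m * q) *: e j_u1.
have Dw f : differentiable f J0 -> 'D_w f J0 =
    partial j_t f J0 - l * partial j_x f J0 + m * q * partial j_u1 f J0.
  by move=> df; rewrite /w !deriveDZ// mulNr.
(* Phi_p vanishes on the zero set of [Phi], and Phi_q <> 0 makes the q-direction transversal to
   it. *)
have T1 : partial j_q Phi J0 * 'D_w (partial j_p Phi) J0
    = 'D_w Phi J0 * partial j_q (partial j_p Phi) J0.
  apply: (tangent_derive_eq0 D) => //; first exact: dpPhi.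
  by move=> s c /= DJ PJ; have [] := onZ _ DJ PJ.
(* On the plane J0 + <e_p, e_q> the defect has constant lam, mu, lam_1, lam_2. *)
pose P (J : 'rV[R]_6) : R := J 0 j_p.
pose Q (J : 'rV[R]_6) : R := J 0 j_q.
pose F : 'rV[R]_6 -> R := partial j_t Phi + cst (- l) * partial j_x Phi
  + cst m * (Q * partial j_u1 Phi)
  + partial j_q Phi * ((cst l1 * P + cst l2 * Q) * Q).
have dF : differentiable F J0.
  have dP : differentiable P J0 by exact: differentiable_coord.
  have dQ : differentiable Q J0 by exact: differentiable_coord.
  have dc (k : R) : differentiable (cst k : 'rV[R]_6 -> R) J0.
    exact: differentiable_cst.
  have d1 := differentiableM (dc (- l)) (dpPhi j_x J0 DJ0).
  have d2 := differentiableM (dc m) (differentiableM dQ (dpPhi j_u1 J0 DJ0)).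
  have d3 := differentiableD (differentiableM (dc l1) dP)
    (differentiableM (dc l2) dQ).
  have d4 := differentiableM (dpPhi j_q J0 DJ0) (differentiableM d3 dQ).
  exact (differentiableD
    (differentiableD (differentiableD (dpPhi j_t J0 DJ0) d1) d2) d4).
have FE : 'D_(e j_p) F J0 = partial j_t (partial j_p Phi) J0
    - l * partial j_x (partial j_p Phi) J0
    + m * (q * partial j_u1 (partial j_p Phi) J0)
    + (partial j_q (partial j_p Phi) J0 * ((l1 * p + l2 * q) * q)
       + partial j_q Phi J0 * (l1 * q)).
  (* Exchanging derivatives expresses everything through first derivatives of Phi_p, the quantities
     that also occur in [T1]. *)
  have is_dp i : is_derive J0 (e j_p) (partial i Phi)
      (partial i (partial j_p Phi) J0).
    split; first exact/diff_derivable/dpPhi.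
    exact: (partial_comm D).
  have is_dP : is_derive J0 (e j_p) P 1.
    split; first exact/diff_derivable/differentiable_coord.
    by rewrite derive_coord mxE.
  have is_dQ : is_derive J0 (e j_p) Q 0.
    split; first exact/diff_derivable/differentiable_coord.
    by rewrite derive_coord mxE.
  have [_ ->] := is_derive_frozen_defect _ _ _ _ _ _ l m l1 l2 _ _ _ _ _ _
    (is_dp j_t) (is_dp j_x) (is_dp j_u1) (is_dp j_q) is_dP is_dQ.
  by [].
(* The right-hand side vanishes because Phi_p = 0 at [J0]: the p-direction is itself tangent. *)
have T2 : partial j_q Phi J0 * 'D_(e j_p) F J0
    = partial j_p Phi J0 * partial j_q F J0.
  apply: (tangent_derive_eq0 D Phi F J0 (e j_p) (e j_q) oD DJ0 dPhi dF PJ0 Pq0).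
  move=> s c /= DJ PJ; have [_ _] := onZ _ DJ PJ.
  set J := c *: _ + _; have uJ : jet_u J = u.
    by rewrite /J !jet_uD !jet_u_delta/= !scaler0 !add0r.
  rewrite /compatibility_defect /dx_of uJ -/l -/m -/l1 -/l2 => def.
  by apply: etrans def; exact: frozen_defectE.
move: T2; rewrite Pp0 mul0r FE => /eqP.
rewrite mulf_eq0 (negbTE Pq0) /= => /eqP {}T2.
rewrite (Dw _ (dPhi _ DJ0)) (Dw _ (dpPhi _ _ DJ0)) in T1.
move: def0; rewrite /compatibility_defect /dx_of uJ0 -/l -/m -/p -/q -/l1 -/l2.
move=> def0.
exact: (defect_elimination _ _ _ _ _ _ _ _ p q l m l1 l2 Pq0 q0 def0 T1 T2).
Qed.

Theorem theorem3 (R : realType) (Omega : set 'rV[R]_2)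
    (lam mu : 'rV[R]_2 -> R)
    (Omega_open : open Omega)
    (lam_smooth : smooth_on Omega lam)
    (mu_smooth : smooth_on Omega mu)
    (mu_neq0 : forall u, Omega u -> mu u != 0) :
  linearly_degenerate Omega (jordan_system lam mu)
  <-> admits_differential_constraint Omega lam mu.
Proof.
have dlam u : Omega u -> differentiable lam u by exact: lam_smooth [::] u.
rewrite (linearly_degenerate_jordanE _ _ _ dlam mu_neq0); split.
  exact: admits_differential_constraint_of_partial_eq0.
exact: partial_eq0_of_admits.
Qed.
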